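(* Let $n\ge 1$ and let $X$ be a finite pure $n$-dimensional simplicial complex with connected links and with a balanced weight function $m$. Assume that there is a constant $0<\lambda<1$ such that for every $0\le k\le n-1$ and every $\tau\in X(k-1)$, $\mathrm{Spec}((M')^+_{\tau,0})\subseteq[-\lambda,\lambda]\cup\{1\}$. Then for all pairwise disjoint sets $U_0,\dots,U_n\subseteq X(0)$, $$\left|m(X(U_0,\dots,U_n))-\frac{m(U_0)m(U_1)\cdots m(U_n)}{m(X(0))^n}\right|\le C_n\lambda\min_{0\le i<j\le n}\sqrt{m(U_i)m(U_j)},$$ where $$C_n=\sum_{k=0}^{n-1}\left((k+1)(k+2)^{n-k}-(k+1)^{n-k+1}\right).$$
   Context: $X(k)$ denotes the set of simplices of $X$ with $k+1$ vertices, $X(-1)=\{\emptyset\}$; a vertex $v$ is identified with $\{v\}\in X(0)$. $X$ is pure $n$-dimensional if every simplex is contained in a simplex of $X(n)$. For $\tau\in X(k)$ the link $X_\tau$ is the complex with $\eta\in X_\tau(l)$ iff $\eta\in X(l)$ and $\tau\cup\eta\in X(k+l+1)$; $X_\emptyset=X$. ''Connected links'' means that for every $-1\le k\le n-2$ and every $\tau\in X(k)$ the one-skeleton of $X_\tau$ (the graph with vertices $X_\tau(0)$ and edges $X_\tau(1)$) is connected; in particular the one-skeleton of $X$ is connected. A balanced weight function is a function $m:\bigcup_{-1\le k\le n}X(k)\to\mathbb{R}^+$ (strictly positive) such that for every $-1\le k\le n-1$ and $\tau\in X(k)$, $m(\tau)=\sum_{\sigma\in X(k+1),\,\tau\subset\sigma}m(\sigma)$.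 For a set $U\subseteq X(k)$ of simplices, $m(U)=\sum_{\sigma\in U}m(\sigma)$. On the link, $m_\tau(\eta)=m(\tau\cup\eta)$. The weighted random walk operator $(M')^+_{\tau,0}$ acts on functions $\phi:X_\tau(0)\to\mathbb{R}$ by $$(M')^+_{\tau,0}\phi(v)=\sum_{u:\{u,v\}\in X_\tau(1)}\frac{m_\tau(\{u,v\})}{m_\tau(\{v\})}\phi(u).$$ For pairwise disjoint $U_0,\dots,U_n\subseteq X(0)$, $X(U_0,\dots,U_n)=\{\sigma\in X(n):|\sigma\cap U_i|=1\text{ for all }0\le i\le n\}$. *)

(* Defs.v *)
From HB Require Import structures.
From mathcomp Require Import all_boot all_order all_algebra.
From mathcomp Require Import reals.

Set Implicit Arguments.
Unset Strict Implicit.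
Unset Printing Implicit Defensive.

Import Order.TTheory GRing.Theory Num.Theory.
Local Open Scope ring_scope.

Section Complexes.
Variable V : finType.
Implicit Types (X : {set {set V}}) (s t tau eta : {set V}).

(* The empty simplex is always a simplex, i.e. X(-1) = {set0}. *)
Definition simplicial_complex X : Prop :=
  set0 \in X /\ (forall s t, s \in X -> t \subset s -> t \in X).

(* Simplices are indexed by their number of vertices rather than by their
   dimension: X(k) is [faces X k.+1], and X(-1) is [faces X 0]. *)
Definition faces X (c : nat) : {set {set V}} := [set s in X | #|s| == c].

Definition vertices X : {set V} := [set v | [set v] \in faces X 1].

Definition pure X (n : nat) : Prop :=
  forall s, s \in X -> exists2 t, t \in faces X n.+1 & s \subset t.

(* The cardinality condition is the requirement that tau :|: eta has dimension
   dim tau + dim eta + 1. *)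
Definition link X tau : {set {set V}} :=
  [set eta in X | tau :|: eta \in faces X (#|tau| + #|eta|)%N].

Definition edge X : rel V := [rel u v | [set u; v] \in faces X 2].

Definition skeleton_connected X : Prop :=
  {in vertices X &, forall u v, connect (edge X) u v}.

(* [c < n] is the range -1 <= k <= n - 2 for the dimension k = c - 1 of tau. *)
Definition connected_links X (n : nat) : Prop :=
  forall c, (c < n)%N -> forall tau, tau \in faces X c ->
    skeleton_connected (link X tau).

Definition transversals X (n : nat) (U : 'I_n.+1 -> {set V}) : {set {set V}} :=
  [set s in faces X n.+1 | [forall i, #|s :&: U i| == 1%N]].

End Complexes.

Section Weights.
Variables (R : realType) (V : finType).
Implicit Types (X S : {set {set V}}) (m : {set V} -> R) (tau : {set V}).

(* Only the values of m on simplices of X matter. [c <= n] is the range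
   -1 <= k <= n - 1 for the dimension k = c - 1 of tau. *)
Definition balanced_weight X (n : nat) m : Prop :=
  (forall s, s \in X -> 0 < m s) /\
  (forall c, (c <= n)%N -> forall tau, tau \in faces X c ->
     m tau = \sum_(s in faces X c.+1 | tau \subset s) m s).

Definition mass m S : R := \sum_(s in S) m s.

(* A vertex v is identified with the simplex [set v]. *)
Definition vmass m (U : {set V}) : R := mass m [set [set v] | v in U].

Definition link_weight m tau : {set V} -> R := fun eta => m (tau :|: eta).

End Weights.

Section RandomWalk.
Variables (R : realType) (V : finType).
Variables (X : {set {set V}}) (m : {set V} -> R) (tau : {set V}).

Definition link_vertex : finType := {v : V | v \in vertices (link X tau)}.

(* R^o is R as a one-dimensional vector space over itself, so that this function
   space is a [vectType R]. *)
Definition link_fun : vectType R := {ffun link_vertex -> R^o}.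

Definition walk (phi : link_fun) : link_fun :=
  [ffun v : link_vertex =>
    \sum_(u : link_vertex | [set val u; val v] \in faces (link X tau) 2)
      (link_weight m tau [set val u; val v] / link_weight m tau [set val v])
        * (phi : {ffun link_vertex -> R^o}) u].

Fact walk_is_linear : linear walk.
Proof.
move=> a f g; apply/ffunP=> v; rewrite !ffunE scaler_sumr -big_split /=.
by apply: eq_bigr => u _; rewrite !ffunE mulrDr; congr (_ + _); rewrite mulrCA.
Qed.

HB.instance Definition _ :=
  GRing.isLinear.Build R link_fun link_fun _ walk walk_is_linear.

Definition walk_op : 'End(link_fun) := linfun walk.

Definition walk_spec : pred R := passmx.leigenvalue walk_op.

Lemma walk_opE phi : walk_op phi = walk phi.
Proof. exact: lfunE. Qed.

Lemma walk_specP a :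
  reflect (exists2 phi, phi != 0 & walk phi = a *: phi) (a \in walk_spec).
Proof.
have memE phi : (phi \in passmx.leigenspace walk_op a) = (walk phi == a *: phi).
  by rewrite memv_ker !lfun_simp subr_eq0.
rewrite unfold_in /walk_spec /passmx.leigenvalue -vpick0.
apply: (iffP idP) => [nz|[phi nz /eqP]].
  exists (vpick (passmx.leigenspace walk_op a)) => //; apply/eqP.
  by rewrite -memE memv_pick.
by rewrite -memE vpick0; apply: contraTneq => ->; rewrite memv0.
Qed.

End RandomWalk.

Definition mixing_const (R : realType) (n : nat) : R :=
  \sum_(0 <= k < n)
     (k.+1%:R * k.+2%:R ^+ (n - k) - k.+1%:R ^+ (n - k).+1).

(* Minimum over all pairs i < j. For 0 < n the default value of the iterated
   minimum is itself one of the terms (i = 0, j = n). *)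
Definition min_pairs (R : realType) (n : nat) (f : 'I_n.+1 -> 'I_n.+1 -> R) : R :=
  \big[Num.min/f ord0 ord_max]_(p : 'I_n.+1 * 'I_n.+1 | (p.1 < p.2)%N) f p.1 p.2.

(* Main.v *)
Require Import Defs.
From HB Require Import structures.
From mathcomp Require Import all_boot all_order all_algebra.
From mathcomp Require Import perm fingroup reals complex zify ring.

(** Let [w (v_k, ..., v_1)] be [m {v_1, ..., v_k}] when the [v_i] are distinct and
    span a simplex, and 0 otherwise; balancedness says that [w] is a consistent
    family of marginals.  For a function [phi] on vertices, let [T phi s] be the
    [w]-average of [phi] over the vertices extending the ordered simplex [s].  On
    the link of [s], [u |-> T phi (u, s)] is the walk operator applied to [phi],
    and [T phi s] is the mean of [phi], so the spectral gap gives
    [sum_u w (u, s) (T phi (u, s) - T phi s)^2 <= lambda^2 sum_u w (u, s) phi(u)^2].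
    These increments are orthogonal, hence over ordered [k]-simplices
    [T phi - mean phi] has squared norm at most [k lambda^2 |phi|^2].  By
    Cauchy-Schwarz, adding a set [B] to a list of [k] sets, one of them [L],
    multiplies the transversal mass by [m(B) / m(X(0))] up to an error
    [k lambda sqrt (m(L) m(B))].  Adding [U_0] last to a list that started with
    [U_n] bounds the total error by
    [(1 + ... + n) lambda sqrt (m(U_0) m(U_n))], and [1 + ... + n <= C_n]; the
    other pairs follow by permuting the sets. *)

Set Implicit Arguments.
Unset Strict Implicit.
Unset Printing Implicit Defensive.

Import Order.TTheory GRing.Theory Num.Theory.
Local Open Scope ring_scope.
Local Open Scope sesquilinear_scope.

(** * Spectral bound for real symmetric matrices and kernels *)

Lemma mul_row_trmxC (C : numClosedFieldType) n (y : 'rV[C]_n) :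
  (y *m y^t*) 0 0 = \sum_i `|y 0 i| ^+ 2.
Proof. by rewrite mxE; apply: eq_bigr => i _; rewrite !mxE normCK. Qed.

(** Over [R[i]] the matrix is Hermitian, hence unitarily diagonalizable with real diagonal. The
    diagonal entries are eigenvalues of [A] itself, and the unitary change of basis preserves the
    norm. *)
Lemma symmetric_mx_contraction (R : rcfType) n (A : 'M[R]_n) (l : R) :
    A^T = A -> (forall a, eigenvalue A a -> `|a| <= l) ->
  forall x : 'rV_n, \sum_i (x *m A) 0 i ^+ 2 <= l ^+ 2 * \sum_i x 0 i ^+ 2.
Proof.
move=> symA specA x.
pose f : {rmorphism R -> R[i]} := real_complex R; pose B := map_mx f A.
have hermB : B \is hermsymmx.
  apply: realsym_hermsym; last by apply/mxOverP => i j; rewrite mxE complex_real.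
  by apply/is_hermitianmxP; rewrite expr0 scale1r map_mx_id // map_trmx symA.
set P := spectralmx B; set d := spectral_diag B.
have unitP : P \is unitarymx := spectral_unitarymx B.
have defB : B = P^t* *m diag_mx d *m P.
  by rewrite -(invmx_unitary unitP); apply/orthomx_spectralP/hermitian_normalmx.
have d_le i : `|d 0 i| <= f l.
  have /complex_realP[a da] : d 0 i \is Num.real.
    exact: (mxOverP (hermitian_spectral_diag_real hermB)).
  rewrite da.
  suff : eigenvalue B (f a).
    rewrite eigenvalue_map => /specA; rewrite -lecR; apply: le_trans.
    by rewrite normc_def /= expr0n addr0 sqrtr_sqr.
  (* Vectors act on the left, so the eigenvectors are the rows of [P]; they are nonzero because [P]
     is invertible. *)
  apply/eigenvalueP; exists (row i P).
    rewrite {1}defB !mulmxA -row_mul; have /unitarymxP-> := unitP.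
    rewrite -row_mul mul1mx row_diag_mx -scalemxAl -rowE da //.
  apply/eqP => /(congr1 (mulmx^~ (invmx P))).
  rewrite -row_mul mulmxV ?spectral_unit // mul0mx => /rowP/(_ i) /eqP.
  by rewrite !mxE eqxx oner_eq0.
have normf (y : 'rV[R]_n) :
    (\sum_i `|map_mx f y 0 i| ^+ 2) = f (\sum_i y 0 i ^+ 2).
  rewrite rmorph_sum; apply: eq_bigr => i _; rewrite mxE -add_Re2_Im2 /=.
  by rewrite expr0n addr0.
rewrite -lecR [leRHS]rmorphM rmorphXn -[in leLHS]normf -normf map_mxM -/B.
set y := map_mx f x; pose z := y *m P^t*.
have -> : \sum_i `|y 0 i| ^+ 2 = \sum_i `|z 0 i| ^+ 2.
  rewrite -!mul_row_trmxC /z trmx_mul map_mxM trmxCK.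
  by rewrite mulmxA mulmxKtV.
have -> : \sum_i `|(y *m B) 0 i| ^+ 2 = \sum_i `|(z *m diag_mx d) 0 i| ^+ 2.
  rewrite -!mul_row_trmxC defB !mulmxA -/z.
  rewrite [(z *m _ *m P)^T]trmx_mul map_mxM mulmxA -[z *m _ *m P *m _]mulmxA.
  by have /unitarymxP-> := unitP; rewrite mulmx1.
rewrite mulr_sumr; apply: ler_sum => i _.
rewrite mul_mx_diag mxE normrM exprMn mulrC ler_wpM2r ?exprn_ge0 //.
by rewrite lerXn2r ?nnegrE ?(le_trans _ (d_le i)).
Qed.

Lemma symmetric_kernel_contraction (R : rcfType) (T : finType)
    (K : T -> T -> R) (l : R) (symK : forall x y, K x y = K y x)
    (specK : forall a (f : T -> R), (exists x, f x != 0) ->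
       (forall x, \sum_y K x y * f y = a * f x) -> `|a| <= l)
    (f : T -> R) :
  \sum_x (\sum_y K x y * f y) ^+ 2 <= l ^+ 2 * \sum_x f x ^+ 2.
Proof.
pose A := \matrix_(i < #|T|, j < #|T|) K (enum_val i) (enum_val j).
have sumE (F : T -> R) : \sum_x F x = \sum_(i < #|T|) F (enum_val i).
  by rewrite (reindex _ (onW_bij _ (@enum_val_bij T))).
have mulA (v : 'rV[R]_#|T|) i :
    (v *m A) 0 i = \sum_x K (enum_val i) x * v 0 (enum_rank x).
  by rewrite mxE sumE; apply: eq_bigr => j _; rewrite mxE symK enum_valK mulrC.
pose v := \row_(i < #|T|) f (enum_val i).
have -> : \sum_x f x ^+ 2 = \sum_i v 0 i ^+ 2.
  by rewrite sumE; apply: eq_bigr => i _; rewrite mxE.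
have -> : \sum_x (\sum_y K x y * f y) ^+ 2 = \sum_i (v *m A) 0 i ^+ 2.
  rewrite sumE; apply: eq_bigr => i _; rewrite mulA; congr (_ ^+ 2).
  by apply: eq_bigr => y _; rewrite mxE enum_rankK.
apply: symmetric_mx_contraction; first by apply/matrixP => i j; rewrite !mxE.
move=> a /eigenvalueP[h hA h_neq0]; apply: (specK a (fun x => h 0 (enum_rank x))).
  have /rV0Pn[i hi] := h_neq0.
  by exists (enum_val i); rewrite enum_valK.
move=> x; have /rowP/(_ (enum_rank x)) := hA.
by rewrite mulA enum_rankK mxE.
Qed.

(** * Random walks on weighted graphs *)

(** Summation by parts shows that the Dirichlet energy of a harmonic function is zero; its terms are
    nonnegative, so each of them vanishes. *)
Lemma harmonic_const_on_edges (R : realFieldType) (T : finType)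
    (g : T -> T -> R) (f : T -> R) (symg : forall x y, g x y = g y x)
    (g_ge0 : forall x y, 0 <= g x y)
    (harm : forall x, \sum_y g x y * f y = (\sum_y g x y) * f x) (x y : T) :
  g x y != 0 -> f x = f y.
Proof.
have energy : \sum_x \sum_y g x y * (f x - f y) ^+ 2 = 0.
  have split_energy u v : g u v * (f u - f v) ^+ 2 =
      f u * (g u v * f u - g u v * f v) - (f v * g u v * f u - g u v * f v * f v).
    by ring.
  transitivity (\sum_u f u * (\sum_v g u v * f u - \sum_v g u v * f v)
     - \sum_u (\sum_v f v * g u v * f u - \sum_v g u v * f v * f v)).
    rewrite -sumrB; apply: eq_bigr => u _.
    rewrite -!sumrB mulr_sumr -sumrB; apply: eq_bigr => v _.
    exact: split_energy.
  rewrite [X in X - _]big1 ?sub0r; last first.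
    by move=> u _; rewrite harm mulr_suml subrr mulr0.
  rewrite sumrB [X in - (_ - X)]exchange_big /= -sumrB big1 ?oppr0 // => u _.
  transitivity (f u * (\sum_v g u v * f v - (\sum_v g u v) * f u)).
    rewrite mulrBr mulr_sumr mulr_suml mulr_sumr -!sumrB.
    by apply: eq_bigr => v _; rewrite (symg v u); ring.
  by rewrite harm subrr mulr0.
have row_ge0 u v : 0 <= g u v * (f u - f v) ^+ 2.
  by rewrite mulr_ge0 ?sqr_ge0.
have row0 := psumr_eq0P (fun u _ => sumr_ge0 _ (fun v _ => row_ge0 u v)) energy.
have /eqP : g x y * (f x - f y) ^+ 2 = 0 by exact: psumr_eq0P (row0 x isT) _ isT.
by rewrite mulf_eq0 sqrf_eq0 subr_eq0 => /orP[->|/eqP].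
Qed.

(* Conjugating the walk by the square root of the degree makes it symmetric; after
   the constants are projected away only the eigenvalues in [-l, l] survive. *)
Lemma weighted_walk_contraction (R : rcfType) (T : finType)
    (g : T -> T -> R) (d : T -> R) (l : R)
    (l_ge0 : 0 <= l)
    (symg : forall x y, g x y = g y x)
    (g_ge0 : forall x y, 0 <= g x y)
    (degE : forall x, d x = \sum_y g x y)
    (conn : forall x y, d x != 0 -> d y != 0 ->
       connect [rel u v | g u v != 0] x y)
    (spec : forall a (f : T -> R), (exists2 x, d x != 0 & f x != 0) ->
       (forall x, \sum_y g x y * f y = a * (d x * f x)) -> `|a| <= l \/ a = 1)
    (f : T -> R) :
  \sum_x d x * ((\sum_y g x y * f y) / d x
                - (\sum_y d y * f y) / (\sum_y d y)) ^+ 2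
  <= l ^+ 2 * \sum_x d x * f x ^+ 2.
Proof.
have d_ge0 x : 0 <= d x by rewrite degE sumr_ge0.
(* Points of degree 0 are allowed: in the application they are the vertices of [V] outside the link.
   All kernel entries at such points vanish, so division by zero does no harm. *)
have g0l x y : d x = 0 -> g x y = 0.
  by rewrite degE => /(psumr_eq0P (fun y _ => g_ge0 x y)); apply.
have g0r x y : d y = 0 -> g x y = 0 by rewrite symg; exact: g0l.
pose r x := Num.sqrt (d x); pose D := \sum_y d y.
have rr x : r x * r x = d x by rewrite -expr2 sqr_sqrtr.
have r0 x : r x = 0 -> d x = 0 by move=> rx0; rewrite -rr rx0 mulr0.
have g0rl x y : r x = 0 -> g x y = 0 by move/r0; exact: g0l.
have g0rr x y : r y = 0 -> g x y = 0 by move/r0; exact: g0r.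
have D0 x : D = 0 -> r x = 0.
  move/(psumr_eq0P (fun y _ => d_ge0 y))/(_ x isT) => dx0.
  by rewrite /r dx0 sqrtr0.
(* The subtracted term is the orthogonal projection onto [r], the image of the constants under
   conjugation; it accounts for the mean in the statement. *)
pose K x y := g x y / (r x * r y) - r x * r y / D.
have KrE (h : T -> R) x : \sum_y K x y * (r y * h y)
    = (\sum_y g x y * h y) / r x - r x * ((\sum_y d y * h y) / D).
  rewrite mulr_suml mulr_suml mulr_sumr -sumrB; apply: eq_bigr => y _.
  rewrite /K mulrBl -(rr y); congr (_ - _); last by ring.
  have [ry0|ry_neq0] := eqVneq (r y) 0; first by rewrite g0rr ?mul0r.
  rewrite invfM -[RHS]mulr1 -(mulVf ry_neq0); ring.
have := @symmetric_kernel_contraction _ _ K l _ _ (fun x => r x * f x).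
have -> : \sum_x (r x * f x) ^+ 2 = \sum_x d x * f x ^+ 2.
  by apply: eq_bigr => x _; rewrite exprMn expr2 rr.
have -> : \sum_x (\sum_y K x y * (r y * f y)) ^+ 2 =
    \sum_x d x * ((\sum_y g x y * f y) / d x - (\sum_y d y * f y) / D) ^+ 2.
  apply: eq_bigr => x _; rewrite KrE -[d x]rr.
  have [rx0|rx_neq0] := eqVneq (r x) 0; first by rewrite rx0 invr0; ring.
  by move: (\sum_y g x y * f y) (_ / D) => S c; field.
apply=> [x y|a h [x0 hx0] eigh].
  by rewrite /K symg [r y * _]mulrC.
have [-> |a_neq0] := eqVneq a 0; first by rewrite normr0.
(* [K] is symmetric and kills [r], so an eigenvector for [a != 0] is orthogonal to [r]. Hence it is
   also an eigenvector of the kernel without the projection, and [h / r] is one of the walk. *)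
have orth : \sum_x r x * h x = 0.
  apply: (mulfI a_neq0); rewrite mulr0 mulr_sumr.
  transitivity (\sum_x r x * \sum_y K x y * h y).
    by apply: eq_bigr => x _; rewrite eigh mulrCA.
  under eq_bigr => x _ do rewrite mulr_sumr.
  rewrite exchange_big big1 //= => y _.
  transitivity ((\sum_x r x * K x y) * h y).
    by rewrite mulr_suml; apply: eq_bigr => x _; rewrite mulrA.
  have -> : \sum_x r x * K x y = \sum_x K y x * (r x * 1).
    by apply: eq_bigr => x _; rewrite /K mulr1 mulrC symg [r y * _]mulrC.
  rewrite KrE; under eq_bigr => x _ do rewrite mulr1.
  under [\sum_x d x * 1]eq_bigr => x _ do rewrite mulr1.
  rewrite -degE -/D -rr.
  have [ry0|ry_neq0] := eqVneq (r y) 0; first by rewrite ry0 !mul0r subrr mul0r.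
  have D_neq0 : D != 0 by apply: contra_neq ry_neq0; exact: D0.
  by rewrite mulfK // divff // mulr1 subrr mul0r.
have eigh' x : \sum_y g x y / (r x * r y) * h y = a * h x.
  rewrite -eigh /K; under [RHS]eq_bigr => y _ do rewrite mulrBl.
  rewrite sumrB -[LHS]subr0; congr (_ - _).
  transitivity (r x / D * \sum_y r y * h y); first by rewrite orth mulr0.
  by rewrite mulr_sumr; apply: eq_bigr => y _; ring.
have h0 x : r x = 0 -> h x = 0.
  move=> rx0; apply: (mulfI a_neq0); rewrite mulr0 -eigh' big1 // => y _.
  by rewrite g0rl ?mul0r.
pose p x := h x / r x.
have hE x : h x = r x * p x.
  have [rx0|rx_neq0] := eqVneq (r x) 0; first by rewrite rx0 mul0r h0.
  by rewrite mulrCA divff ?mulr1.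
have eigp x : \sum_y g x y * p y = a * (d x * p x).
  have [rx0|rx_neq0] := eqVneq (r x) 0.
    by rewrite r0 // mul0r mulr0 big1 // => y _; rewrite g0rl ?mul0r.
  rewrite -rr -mulrA -hE mulrCA -eigh' mulr_sumr; apply: eq_bigr => y _.
  have [ry0|ry_neq0] := eqVneq (r y) 0; first by rewrite g0rr // !mul0r mulr0.
  by rewrite /p; field; rewrite ry_neq0.
have rx0_neq0 : r x0 != 0 by apply: contra_neq hx0; exact: h0.
have dx0 : d x0 != 0 by rewrite -rr mulf_neq0.
case: (spec a p) => // [|a1].
  by exists x0; rewrite // mulf_neq0 ?invr_eq0.
(* If [a = 1], then [p] is harmonic, hence constant where [d] is nonzero, by connectedness.
   Orthogonality to [r] then makes this constant zero, against [h x0 != 0]. *)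
have const_p x : d x != 0 -> p x = p x0.
  move=> dx; have /connectP[s] := conn _ _ dx dx0.
  elim: s x {dx} => [x _ ->|y s IHs x /= /andP[gxy path_s] last_s] //.
  rewrite -(IHs y path_s last_s).
  apply: (harmonic_const_on_edges (g := g)) gxy => // z.
  by rewrite eigp a1 mul1r degE.
have : p x0 * D = 0.
  rewrite -orth mulr_sumr; apply: eq_bigr => x _; rewrite hE mulrA rr mulrC.
  by have [-> |/const_p ->] := eqVneq (d x) 0; rewrite ?mul0r.
move/eqP; rewrite mulf_eq0 => /orP[|/eqP/(D0 x0)/eqP]; last first.
  by rewrite (negPf rx0_neq0).
by rewrite mulf_eq0 invr_eq0 (negPf hx0) (negPf rx0_neq0).
Qed.

(** * Sums over tuples and weighted Cauchy-Schwarz *)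

Lemma sum_tuple_cons (R : nmodType) (T : finType) k (F : seq T -> R) :
  \sum_(s : k.+1.-tuple T) F s = \sum_(s : k.-tuple T) \sum_(x : T) F (x :: s).
Proof.
rewrite pair_bigA (reindex (fun p : k.-tuple T * T => [tuple of p.2 :: p.1])) //=.
exists (fun s : k.+1.-tuple T => ([tuple of behead s], thead s)).
  by case=> s x _ /=; congr pair; apply: val_inj.
by move=> s _; rewrite [RHS]tuple_eta; apply: val_inj.
Qed.

Lemma sum_tuple0 (R : nmodType) (T : finType) (F : seq T -> R) :
  \sum_(s : 0.-tuple T) F s = F [::].
Proof.
by rewrite (big_pred1 [tuple]) // => s; apply/esym/eqP; rewrite [LHS]tuple0.
Qed.

(** With [S] the total weight, [Y] the weighted sum and [Q] the weighted sum of squares, the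
    nonnegative sum of [a i * (S * f i - Y) ^+ 2] equals [S * (S * Q - Y ^+ 2)]. *)
Lemma weighted_cauchy_schwarz (R : realFieldType) (I : finType) (P : pred I)
    (a f : I -> R) (a_ge0 : forall i, 0 <= a i) :
  (\sum_(i | P i) a i * f i) ^+ 2
  <= (\sum_(i | P i) a i) * \sum_(i | P i) a i * f i ^+ 2.
Proof.
set Y := \sum_(i | P i) a i * f i; set S := \sum_(i | P i) a i.
set Q := (X in _ <= _ * X).
have S_ge0 : 0 <= S by rewrite sumr_ge0.
have [S0|S_neq0] := eqVneq S 0.
  rewrite S0 mul0r /Y big1 ?expr0n // => i Pi.
  by rewrite (psumr_eq0P (fun i _ => a_ge0 i) S0) ?mul0r.
have : 0 <= \sum_(i | P i) a i * (S * f i - Y) ^+ 2.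
  by apply: sumr_ge0 => i _; rewrite mulr_ge0 ?sqr_ge0.
have -> : \sum_(i | P i) a i * (S * f i - Y) ^+ 2 = S * (S * Q - Y ^+ 2).
  transitivity (S ^+ 2 * Q - (2 * S * Y) * Y + Y ^+ 2 * S); last by ring.
  have mulY (c : R) : c * Y = \sum_(i | P i) c * (a i * f i) by exact: mulr_sumr.
  have mulS (c : R) : c * S = \sum_(i | P i) c * a i by exact: mulr_sumr.
  rewrite (mulY (2 * S * Y)) (mulS (Y ^+ 2)) mulr_sumr -sumrB -big_split /=.
  by apply: eq_bigr => i _; ring.
by rewrite pmulr_rge0 ?subr_ge0 // lt_def S_neq0.
Qed.

(** * Weights of ordered simplices *)

Section OrderedWeight.
Variables (R : realType) (V : finType) (n : nat).
Variables (X : {set {set V}}) (m : {set V} -> R) (lambda : R).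
Hypothesis X_complex : simplicial_complex X.
Hypothesis X_links : connected_links X n.
Hypothesis m_balanced : balanced_weight X n m.
Hypothesis lambda_ge0 : 0 <= lambda.
Hypothesis X_spec : forall k, (k < n)%N -> forall tau, tau \in faces X k ->
  forall a : R, a \in walk_spec X m tau -> `|a| <= lambda \/ a = 1.

(* Working with ordered simplices removes all the factorials. *)
Definition ordered_weight (s : seq V) : R :=
  if uniq s && ([set x in s] \in X) then m [set x in s] else 0.
Local Notation w := ordered_weight.

Lemma ordered_weight_ge0 s : 0 <= w s.
Proof.
by rewrite /w; case: ifP => // /andP[_ /(m_balanced.1)]; exact: ltW.
Qed.

Lemma ordered_weight_neq0 s : (w s != 0) = uniq s && ([set x in s] \in X).
Proof.
rewrite /w; case: ifP => [/andP[_ /(m_balanced.1)]|_]; last by rewrite eqxx.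
by move/gt_eqF ->.
Qed.

Lemma ordered_weightE s : w s != 0 -> w s = m [set x in s].
Proof. by rewrite ordered_weight_neq0 /w => ->. Qed.

Lemma ordered_weight_perm s t : perm_eq s t -> w s = w t.
Proof.
move=> st; rewrite /w (perm_uniq st).
suff -> : [set x in s] = [set x in t] by [].
by apply/setP => x; rewrite !inE (perm_mem st).
Qed.

Lemma ordered_weight_swap u v s : w (u :: v :: s) = w (v :: u :: s).
Proof. by apply/ordered_weight_perm/seq.permP => p /=; rewrite addnCA. Qed.

Lemma ordered_weight_cons0 v s : w s = 0 -> w (v :: s) = 0.
Proof.
move/eqP=> ws0; apply/eqP; apply: contraTT ws0.
rewrite !ordered_weight_neq0 /= => /andP[/andP[_ ->] vsX] /=.
by apply: X_complex.2 vsX _; apply/subsetP => x; rewrite !inE orbC => ->.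
Qed.

Lemma card_simplex s : w s != 0 -> #|[set x in s]| = size s.
Proof.
rewrite ordered_weight_neq0 => /andP[/card_uniqP <- _].
by apply: eq_card => x; rewrite inE.
Qed.

Lemma mem_faces s : w s != 0 -> [set x in s] \in faces X (size s).
Proof.
move=> ws; rewrite inE card_simplex // eqxx andbT.
by move: ws; rewrite ordered_weight_neq0 => /andP[].
Qed.

Lemma set_cons (v : V) (s : seq V) : [set x in v :: s] = v |: [set x in s].
Proof. by apply/setP => x; rewrite !inE. Qed.

(** A coface with one more vertex arises from exactly one added vertex [v], so the sum over [v] is
    the balancing sum, without multiplicities. *)
Lemma ordered_weight_balanced s : (size s <= n)%N -> \sum_v w (v :: s) = w s.
Proof.
move=> sn; have [ws0|ws] := eqVneq (w s) 0.
  by rewrite ws0 big1 // => v _; exact: ordered_weight_cons0.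
rewrite ordered_weightE // (m_balanced.2 _ sn _ (mem_faces ws)).
pose A := [set v | w (v :: s) != 0].
have injA : {in A &, injective (fun v => v |: [set x in s])}.
  move=> u v; rewrite !inE !ordered_weight_neq0 /= => /andP[/andP[us _] _] _.
  by move/setP/(_ u); rewrite !inE eqxx (negPf us) !orbF => /esym/eqP.
have -> : \sum_(t in faces X (size s).+1 | [set x in s] \subset t) m t
    = \sum_(t in [set v |: [set x in s] | v in A]) m t.
  apply: eq_bigl => t; apply/andP/imsetP => [[]|[v]].
    rewrite inE => /andP[tX /eqP tcard] st.
    have /cards1P[v tv] : #|t :\: [set x in s]| == 1%N.
      by rewrite cardsD (setIidPr st) card_simplex // tcard subSnn.
    have t_def : t = v |: [set x in s].
      by rewrite -[LHS](setID t [set x in s]) (setIidPr st) tv setUC.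
    exists v => //; rewrite inE ordered_weight_neq0 set_cons -t_def tX andbT /=.
    have : v \in t :\: [set x in s] by rewrite tv set11.
    by rewrite !inE => /andP[-> _]; move: ws; rewrite ordered_weight_neq0 => /andP[].
  rewrite inE => wvs ->; rewrite subsetUr; split => //.
  by rewrite -set_cons; exact: mem_faces wvs.
rewrite big_imset //= [RHS]big_mkcond; apply: eq_bigr => v _; rewrite inE.
have [// | wvs] := eqVneq (w (v :: s)) 0.
by rewrite ordered_weightE // set_cons.
Qed.

(** * Links of ordered simplices and their walks *)

Lemma mem_link_vertices s u : w s != 0 ->
  (u \in vertices (link X [set x in s])) = (w (u :: s) != 0).
Proof.
move=> ws; move: (ws); rewrite !ordered_weight_neq0 => /andP[uniq_s _].
rewrite !inE cards1 eqxx andbT /= uniq_s andbT card_simplex // set_cons setUC.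
apply/andP/andP => [[_ /andP[usX]]|[us usX]].
  rewrite cardsU1 card_simplex // inE addn1 -[X in _ == X]add1n eqn_add2r.
  by case: (u \in s).
split; first by apply: X_complex.2 usX _; rewrite subsetUl.
by rewrite usX cardsU1 card_simplex // inE us addnC eqxx.
Qed.

Lemma mem_link_edges s u v : w s != 0 ->
  ([set u; v] \in faces (link X [set x in s]) 2) = (w (u :: v :: s) != 0).
Proof.
move=> ws; move: (ws); rewrite !ordered_weight_neq0 => /andP[uniq_s _].
rewrite !inE /= uniq_s andbT card_simplex // !set_cons.
rewrite [[set x in s] :|: _]setUC -setUA cards2.
(* The cardinality condition of the link keeps [u] and [v] out of [s] but allows [u = v]; that case
   is excluded by the requirement that an edge has two vertices. *)
have -> : (#|u |: (v |: [set x in s])| == size s + (u != v).+1)%N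
    = (u == v) && (v \notin s) || (u != v) && (u \notin s) && (v \notin s).
  rewrite !cardsU1 card_simplex // !inE; case: (eqVneq u v) => [->|_] /=.
    by case: (v \in s); lia.
  by case: (u \in s); case: (v \in s); lia.
rewrite in_cons; case: (eqVneq u v) => [->|_] /=; first by rewrite andbF.
rewrite andbT; case uvsX: (u |: (_ |: _) \in X); last by rewrite !andbF.
have -> : [set u; v] \in X.
  by apply: X_complex.2 uvsX _; rewrite setUA subsetUl.
by rewrite !andbT.
Qed.

Definition step_mean (phi : V -> R) (s : seq V) : R :=
  (\sum_v w (v :: s) * phi v) / w s.

(** No side condition is needed: if [w s] is 0, then [w] vanishes on all extensions of [s]. *)
Lemma step_meanK phi s : w s * step_mean phi s = \sum_v w (v :: s) * phi v.
Proof.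
have [ws0|ws] := eqVneq (w s) 0; last by rewrite mulrC divfK.
by rewrite ws0 mul0r big1 // => v _; rewrite ordered_weight_cons0 ?mul0r.
Qed.

Lemma link_weight_vertex s v : w (v :: s) != 0 ->
  link_weight m [set x in s] [set v] = w (v :: s).
Proof. by move=> wvs; rewrite ordered_weightE // set_cons setUC. Qed.

Lemma link_weight_edge s u v : w (u :: v :: s) != 0 ->
  link_weight m [set x in s] [set u; v] = w (u :: v :: s).
Proof.
by move=> ws; rewrite ordered_weightE // !set_cons /link_weight setUC setUA.
Qed.

(** Carries the spectral hypothesis, which concerns functions on the vertices of the link, over to
    functions on all of [V], where vertices outside the link have weight 0. *)
Lemma walk_eigenfunction s a (f : V -> R) : (size s < n)%N -> w s != 0 ->
    (exists2 x, w (x :: s) != 0 & f x != 0) ->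
    (forall x, \sum_y w (y :: x :: s) * f y = a * (w (x :: s) * f x)) ->
  `|a| <= lambda \/ a = 1.
Proof.
move=> sn ws [x0 wx0 fx0] eigf; apply: X_spec sn _ (mem_faces ws) _ _.
pose phi : link_fun R X [set x in s] :=
  [ffun v : link_vertex X [set x in s] => f (val v)].
have phiE v : (phi : {ffun _ -> R^o}) v = f (val v) by rewrite ffunE.
apply/walk_specP; exists phi.
  have x0L : x0 \in vertices (link X [set x in s]) by rewrite mem_link_vertices.
  apply: contra_neq fx0 => phi0.
  by have := phiE (Sub x0 x0L); rewrite phi0 ffunE => <-.
apply/ffunP => v; rewrite !ffunE.
have wv : w (val v :: s) != 0 by rewrite -mem_link_vertices // (valP v).
apply: (mulfI wv); rewrite [a *: _]/(a * _) [RHS]mulrCA -eigf mulr_sumr.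
(* The guard makes the summand vanish off the edges at [v], so that the sum over the link can be
   compared with the sum over [V]. *)
pose F u := if w (u :: val v :: s) != 0 then w (u :: val v :: s) * f u else 0.
transitivity (\sum_(u : link_vertex X [set x in s] | w (val u :: val v :: s) != 0)
    F (val u)).
  apply: eq_big => u; first by rewrite mem_link_edges.
  rewrite mem_link_edges // => wuv.
  rewrite phiE link_weight_vertex // link_weight_edge // /F wuv.
  by rewrite mulrA mulrCA divff ?mulr1.
rewrite -(big_sub_cond (mem (vertices (link X [set x in s])))
  [pred u | w (u :: val v :: s) != 0] F) [LHS]big_mkcond.
apply: eq_bigr => u _; rewrite mem_link_vertices // /F inE.
have [-> | wuv] := eqVneq (w (u :: val v :: s)) 0; first by rewrite andbF mul0r.
suff -> : w (u :: s) != 0 by [].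
by apply: contra_neq wuv => wu; rewrite ordered_weight_swap ordered_weight_cons0.
Qed.

(** Apply [weighted_walk_contraction] with edge weights [w (y :: x :: s)] and degrees [w (x :: s)].
    Balancedness at [x :: s] identifies the degrees and uses [size s < n]. *)
Lemma link_contraction s (phi : V -> R) : (size s < n)%N ->
  \sum_u w (u :: s) * (step_mean phi (u :: s) - step_mean phi s) ^+ 2
  <= lambda ^+ 2 * \sum_u w (u :: s) * phi u ^+ 2.
Proof.
move=> sn; have [ws0|ws] := eqVneq (w s) 0.
  by rewrite !big1 ?mulr0 // => u _; rewrite ordered_weight_cons0 ?mul0r.
have degE x : w (x :: s) = \sum_y w (y :: x :: s) by rewrite ordered_weight_balanced.
have sumE : \sum_y w (y :: s) = w s by rewrite ordered_weight_balanced // ltnW.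
have := @weighted_walk_contraction _ _ (fun x y => w (y :: x :: s))
  (fun x => w (x :: s)) lambda lambda_ge0 (fun x y => ordered_weight_swap y x s)
  (fun x y => ordered_weight_ge0 _) degE _ _ phi.
rewrite sumE; apply=> [x y wx wy|a f].
  have := X_links sn (mem_faces ws).
  move=> /(_ x y); rewrite !mem_link_vertices // => /(_ wx wy).
  apply: connect_sub => u v; rewrite /edge /= mem_link_edges // => wuv.
  by apply: connect1; rewrite /= ordered_weight_swap.
exact: walk_eigenfunction.
Qed.

(** * Variance of the step means *)

Lemma ordered_weight_marginal k u : (k <= n)%N ->
  \sum_(s : k.-tuple V) w (u :: s) = w [:: u].
Proof.
elim: k => [|k IHk] kn; first by rewrite (sum_tuple0 (fun s => w (u :: s))).
rewrite (sum_tuple_cons k (fun s => w (u :: s))) -IHk 1?ltnW //.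
apply: eq_bigr => s _; under eq_bigr => x _ do rewrite ordered_weight_swap.
by rewrite ordered_weight_balanced //= size_tuple.
Qed.

(* The increments of [step_mean] along a random ordered simplex form a martingale,
   so their squared norms add up. *)
Lemma step_mean_variance k (phi : V -> R) : (k <= n)%N ->
  \sum_(s : k.-tuple V) w s * (step_mean phi s - step_mean phi [::]) ^+ 2
  <= k%:R * (lambda ^+ 2 * \sum_u w [:: u] * phi u ^+ 2).
Proof.
set c := step_mean phi [::]; set E := lambda ^+ 2 * _.
elim: k => [|k IHk] kn.
  rewrite (sum_tuple0 (fun s => w s * (step_mean phi s - c) ^+ 2)).
  by rewrite subrr expr0n mulr0 mul0r.
rewrite (sum_tuple_cons k (fun s => w s * (step_mean phi s - c) ^+ 2)).
have pythagoras (s : k.-tuple V) :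
    \sum_u w (u :: s) * (step_mean phi (u :: s) - c) ^+ 2
    = \sum_u w (u :: s) * (step_mean phi (u :: s) - step_mean phi s) ^+ 2
      + w s * (step_mean phi s - c) ^+ 2.
  set t := step_mean phi s.
  have sumw : \sum_u w (u :: s) = w s.
    by rewrite ordered_weight_balanced // size_tuple ltnW.
  (* Given [s], the increment has mean zero: exchanging the sums and summing out [u] over [v :: s]
     leaves the average at [s]. This kills the cross term in the square. *)
  have mart : \sum_u w (u :: s) * (step_mean phi (u :: s) - t) = 0.
    under eq_bigr => u _ do rewrite mulrBr step_meanK.
    rewrite sumrB -mulr_suml sumw step_meanK exchange_big /= -sumrB big1 // => v _.
    under eq_bigr => u _ do rewrite ordered_weight_swap.
    by rewrite -mulr_suml ordered_weight_balanced ?subrr //= size_tuple.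
  have cross : \sum_u 2 * (t - c) * (w (u :: s) * (step_mean phi (u :: s) - t)) = 0.
    by rewrite -mulr_sumr mart mulr0.
  rewrite -sumw mulr_suml -big_split /= -[RHS]addr0 -[X in _ = _ + X]cross.
  by rewrite -big_split; apply: eq_bigr => u _ /=; ring.
under eq_bigr => s _ do rewrite pythagoras.
rewrite big_split /= -natr1 mulrDl mul1r addrC lerD ?IHk 1?ltnW //.
apply: (@le_trans _ _
  (\sum_(s : k.-tuple V) lambda ^+ 2 * \sum_u w (u :: s) * phi u ^+ 2)).
  by apply: ler_sum => s _; apply: link_contraction; rewrite size_tuple.
rewrite -mulr_sumr ler_wpM2l ?sqr_ge0 // exchange_big /=; apply: ler_sum => u _.
by rewrite -mulr_suml ordered_weight_marginal // ltnW.
Qed.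

(** * Masses of transversals *)

Local Notation vm A := (\sum_(v in A) w [:: v]).

(** [all2] also compares lengths, so the value is 0 unless [r] has [k] entries. *)
Definition transversal_weight k (r : seq {set V}) : R :=
  \sum_(s : k.-tuple V | all2 (fun v (A : {set V}) => v \in A) s r) w s.
Local Notation W := transversal_weight.

Lemma transversal_weight_cons k (B : {set V}) r :
  W k.+1 (B :: r)
  = \sum_(s : k.-tuple V | all2 (fun v (A : {set V}) => v \in A) s r)
      \sum_(u in B) w (u :: s).
Proof.
rewrite /W big_mkcond (sum_tuple_cons k (fun s =>
  if all2 (fun v (A : {set V}) => v \in A) s (B :: r) then w s else 0)).
rewrite [RHS]big_mkcond; apply: eq_bigr => s _ /=.
case: ifP => _; last by rewrite big1 // => u _; rewrite andbF.
by rewrite [RHS]big_mkcond; apply: eq_bigr => u _; rewrite andbT.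
Qed.

Lemma vm_ge0 (A : {set V}) : 0 <= vm A.
Proof. by apply: sumr_ge0 => v _; exact: ordered_weight_ge0. Qed.

Lemma vm_le_total (A : {set V}) : vm A <= w [::].
Proof.
rewrite -ordered_weight_balanced // big_mkcond; apply: ler_sum => v _.
by case: ifP => _; rewrite ?ordered_weight_ge0.
Qed.

Lemma total_gt0 : 0 < w [::].
Proof.
rewrite lt_def ordered_weight_ge0 ordered_weight_neq0 andbT /=.
suff -> : [set x in [::]] = set0 :> {set V} by exact: X_complex.1.
by apply/setP => x; rewrite !inE.
Qed.

Lemma transversal_weight_ge0 k r : 0 <= W k r.
Proof. by apply: sumr_ge0 => s _; exact: ordered_weight_ge0. Qed.

Lemma transversal_weight1 (L : {set V}) : W 1 [:: L] = vm L.
Proof.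
rewrite transversal_weight_cons big_mkcond.
rewrite (sum_tuple0 (fun s => if all2 (fun v (A : {set V}) => v \in A) s [::]
  then \sum_(u in L) w (u :: s) else 0)) //.
Qed.

(** Dropping the constraint on the first vertex can only increase the sum, and balancedness then
    removes that vertex; repeat until only [L] is left. *)
Lemma transversal_weight_le_last r (L : {set V}) : (size r <= n)%N ->
  W (size r).+1 (rcons r L) <= vm L.
Proof.
elim: r => [|B r IHr] rn; first by rewrite transversal_weight1.
apply: le_trans (IHr (ltnW rn)); rewrite rcons_cons transversal_weight_cons.
apply: ler_sum => s _; rewrite -ordered_weight_balanced ?size_tuple //.
rewrite big_mkcond; apply: ler_sum => v _.
by case: ifP => _; rewrite ?ordered_weight_ge0.
Qed.

Lemma transversal_weight_step k (B : {set V}) r : (k <= n)%N ->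
  `|W k.+1 (B :: r) - vm B / w [::] * W k r|
  <= k%:R * lambda * Num.sqrt (W k r * vm B).
Proof.
(* For the indicator of [B], [w s * step_mean phi s] is the weight of the extensions of [s] by a
   vertex of [B], and the mean [c] is [vm B / w [::]]. *)
move=> kn; pose phi v : R := (v \in B)%:R.
have sumphi s : \sum_v w (v :: s) * phi v = \sum_(v in B) w (v :: s).
  rewrite [RHS]big_mkcond; apply: eq_bigr => v _.
  by rewrite /phi; case: ifP; rewrite ?mulr1 ?mulr0.
have sumphi2 : \sum_u w [:: u] * phi u ^+ 2 = vm B.
  rewrite -sumphi; apply: eq_bigr => v _.
  by rewrite /phi; case: (v \in B); rewrite ?expr1n ?expr0n.
set c := step_mean phi [::].
have -> : W k.+1 (B :: r) - vm B / w [::] * W k r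
    = \sum_(s : k.-tuple V | all2 (fun v (A : {set V}) => v \in A) s r)
        w s * (step_mean phi s - c).
  rewrite transversal_weight_cons mulr_sumr -sumrB; apply: eq_bigr => s _.
  by rewrite mulrBr step_meanK sumphi /c /step_mean sumphi [_ * w s]mulrC.
set Y := \sum_(s | _) _.
have Y2 : Y ^+ 2 <= W k r * (k%:R * (lambda ^+ 2 * vm B)).
  have := weighted_cauchy_schwarz
    (fun s : k.-tuple V => all2 (fun v (A : {set V}) => v \in A) s r)
    (fun s : k.-tuple V => step_mean phi s - c)
    (fun s : k.-tuple V => ordered_weight_ge0 s).
  move/le_trans; apply; rewrite ler_wpM2l ?transversal_weight_ge0 //.
  rewrite -sumphi2; apply: le_trans (step_mean_variance phi kn).
  (* The variance over transversals is at most the variance over all tuples. *)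
  rewrite big_mkcond; apply: ler_sum => s _.
  by case: ifP => _ //; rewrite mulr_ge0 ?sqr_ge0 ?ordered_weight_ge0.
have Z_ge0 : 0 <= W k r * vm B by rewrite mulr_ge0 ?transversal_weight_ge0 ?vm_ge0.
have kl_ge0 : 0 <= k%:R * lambda by rewrite mulr_ge0.
rewrite -sqrtr_sqr -[leRHS](ger0_norm (mulr_ge0 kl_ge0 (sqrtr_ge0 _))) -sqrtr_sqr.
apply: ler_wsqrtr; apply: le_trans Y2 _; rewrite !exprMn sqr_sqrtr //.
have -> : W k r * (k%:R * (lambda ^+ 2 * vm B)) = k%:R * (lambda ^+ 2 * (W k r * vm B)).
  by ring.
rewrite -[leRHS]mulrA ler_wpM2r ?mulr_ge0 ?sqr_ge0 ?transversal_weight_ge0 ?vm_ge0 //.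
(* Cauchy-Schwarz yields the factor [sqrt k]; it is weakened to [k]. *)
by rewrite -natrX ler_nat; case: (k) => // j; rewrite expnS expn1 leq_pmulr.
Qed.

(** Each new set [B] scales the old error by [vm B / w [::]] and adds a new one. The scaling lets
    [vm B] replace the mass of the previous head under the root, so only the coefficients add up. *)
Lemma transversal_weight_estimate r (L : {set V}) : (size r <= n)%N ->
  `|W (size r).+1 (rcons r L) - \prod_(A <- r) (vm A / w [::]) * vm L|
  <= (\sum_(0 <= i < size r) i.+1%:R) * lambda
     * Num.sqrt (vm L * (if r is B :: _ then vm B else w [::])).
Proof.
elim: r => [|B r IHr] rn.
  by rewrite transversal_weight1 big_nil mul1r subrr normr0 big_geq // !mul0r.
have M_gt0 := total_gt0; have b_ge0 := vm_ge0 B; have L_ge0 := vm_ge0 L.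
(* For empty [r] the old error is zero; the default [w [::]] is chosen so that [h <= w [::]] holds
   in both cases. *)
set h := if r is A :: _ then vm A else w [::] in IHr.
have h_ge0 : 0 <= h by rewrite /h; case: (r) => [|A _]; rewrite ?vm_ge0 // ltW.
have h_le : h <= w [::] by rewrite /h; case: (r) => [|A _]; rewrite ?vm_le_total.
rewrite rcons_cons big_cons /= big_nat_recr //= !mulrDl.
set P := \prod_(A <- r) _ in IHr *; set c := \sum_(0 <= i < _) _ in IHr *.
have c_ge0 : 0 <= c by rewrite /c sumr_ge0.
set b := vm B / w [::].
have b_ge0' : 0 <= b by rewrite divr_ge0 // ltW.
have b_le1 : b <= 1 by rewrite ler_pdivrMr ?mul1r ?vm_le_total.
apply: le_trans (ler_distD (b * W (size r).+1 (rcons r L)) _ _) _.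
rewrite addrC; apply: lerD.
  rewrite -mulrA -mulrBr normrM ger0_norm //.
  apply: le_trans (ler_wpM2l b_ge0' (IHr (ltnW rn))) _.
  rewrite mulrCA ler_wpM2l ?mulr_ge0 //.
  rewrite -[in leLHS](ger0_norm b_ge0') -sqrtr_sqr -sqrtrM ?sqr_ge0 //.
  apply: ler_wsqrtr.
  (* One factor [b] supplies [vm B]; the remaining [b] and [h / w [::]] are at most 1. *)
  have -> : b ^+ 2 * (vm L * h) = vm L * vm B * (b * (h / w [::])).
    by rewrite /b; field; rewrite gt_eqF.
  have hM_ge0 : 0 <= h / w [::] by rewrite divr_ge0 // ltW.
  have hM_le1 : h / w [::] <= 1 by rewrite ler_pdivrMr ?mul1r.
  exact: ler_piMr (mulr_ge0 L_ge0 b_ge0) (mulr_ile1 b_ge0' hM_ge0 b_le1 hM_le1).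
apply: le_trans (transversal_weight_step B (rcons r L) rn) _.
rewrite ler_wpM2l ?mulr_ge0 // ler_wsqrtr // ler_wpM2r //.
by rewrite transversal_weight_le_last // ltnW.
Qed.

(** * Return to unordered simplices *)

Lemma vmassE (A : {set V}) : A \subset vertices X -> vmass m A = vm A.
Proof.
move=> AX; rewrite /vmass /mass big_imset /=; last by move=> u v _ _; exact: set1_inj.
apply: eq_bigr => v /(subsetP AX); rewrite !inE => /andP[vX _].
by rewrite /w /= set_cons [[set x in [::]]](_ : _ = set0) ?setU0 ?vX.
Qed.

Lemma mass_verticesE : mass m (faces X 1) = w [::].
Proof.
have w0 : w [::] != 0 by rewrite gt_eqF ?total_gt0.
rewrite (ordered_weightE w0) (m_balanced.2 0%N _ _ (mem_faces w0)) //.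
by apply: eq_bigl => s; rewrite [[set x in [::]]](_ : _ = set0) ?sub0set ?andbT.
Qed.

(** By disjointness a transversal has exactly one ordering whose [i]-th vertex lies in [U i], so it
    is counted once. *)
Lemma transversalsE (U : 'I_n.+1 -> {set V}) :
    (forall i j, i != j -> [disjoint U i & U j]) ->
  mass m (transversals X U) = W n.+1 (codom U).
Proof.
move=> disjU.
have disjE i j x : x \in U i -> x \in U j -> i = j.
  move=> xi xj; apply/eqP; apply: contraTT xj => /disjU; rewrite disjoint_sym.
  by move/disjointFl->.
have all2E (s : n.+1.-tuple V) :
    all2 (fun v (A : {set V}) => v \in A) s (codom U)
    = [forall i, tnth s i \in U i].
  rewrite all2E size_tuple size_codom card_ord eqxx /=.
  rewrite -[X in zip X _](map_tnth_enum s) zip_map all_map.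
  by apply/allP/forallP => sU i => [|_]; apply: sU; rewrite mem_enum.
rewrite /W (eq_bigl _ _ all2E).
(* Tuples of weight 0 span no simplex with [n.+1] vertices and are discarded to get a bijection. *)
pose A := [set s : n.+1.-tuple V | [forall i, tnth s i \in U i] && (w s != 0)].
pose h (s : n.+1.-tuple V) : {set V} := [set x in s].
have memA s : s \in A -> forall i, tnth s i \in U i.
  by rewrite inE => /andP[/forallP sU _].
have inj_h : {in A &, injective h}.
  move=> s t /memA sU /memA tU /setP st; apply: eq_from_tnth => i.
  have := st (tnth s i); rewrite !inE mem_tnth => /esym/tnthP[j sitj].
  by rewrite sitj (disjE i j (tnth s i)) // sitj.
have -> : transversals X U = h @: A.
  apply/setP => t; apply/idP/imsetP => [|[s sA ->]].
    rewrite !inE => /andP[/andP[tX /eqP tcard] /forallP tU].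
    have pick_t i : exists x, t :&: U i == [set x].
      by have /cards1P[x ->] := tU i; exists x.
    pose x i := xchoose (pick_t i).
    have xE i : t :&: U i = [set x i] by apply/eqP/(xchooseP (pick_t i)).
    have xtU i : (x i \in t) && (x i \in U i) by rewrite -in_setI xE set11.
    have inj_x : injective x.
      move=> i j xij; apply: (disjE i j (x i)); first by case/andP: (xtU i).
      by rewrite xij; case/andP: (xtU j).
    pose s := [tuple x i | i < n.+1].
    have uniq_s : uniq s by rewrite /= map_inj_uniq ?enum_uniq.
    have hs : h s = t.
      apply/eqP; rewrite eqEcard tcard; apply/andP; split.
        by apply/subsetP => y; rewrite inE => /mapP[i _ ->]; case/andP: (xtU i).
      by rewrite cardsE (card_uniqP uniq_s) size_tuple.
    exists s => //; rewrite inE ordered_weight_neq0 uniq_s -/(h s) hs tX !andbT.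
    by apply/forallP => i; rewrite tnth_mktuple; case/andP: (xtU i).
  have sU := memA s sA; have := sA; rewrite inE => /andP[_ ws].
  rewrite !inE; have := mem_faces ws; rewrite inE size_tuple => -> /=.
  apply/forallP => i; apply/cards1P; exists (tnth s i); apply/setP => y.
  rewrite !inE; apply/andP/eqP => [[/tnthP[j ->] sjU]|->].
    by rewrite (disjE i j (tnth s j)).
  by rewrite mem_tnth.
rewrite /mass big_imset //= [RHS]big_mkcond [LHS]big_mkcond; apply: eq_bigr => s _.
rewrite inE; case: forallP => //= _.
by have [-> | ws] := eqVneq (w s) 0; rewrite // ordered_weightE.
Qed.

Lemma mixing_head_last (U : 'I_n.+1 -> {set V}) : (0 < n)%N ->
    (forall i, U i \subset vertices X) ->
    (forall i j, i != j -> [disjoint U i & U j]) ->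
  `|mass m (transversals X U)
     - (\prod_(i < n.+1) vmass m (U i)) / mass m (faces X 1) ^+ n|
  <= (\sum_(0 <= i < n) i.+1%:R) * lambda
     * Num.sqrt (vmass m (U ord0) * vmass m (U ord_max)).
Proof.
move=> n_gt0 UX disjU; rewrite transversalsE // mass_verticesE !vmassE //.
rewrite (eq_bigr _ (fun i _ => vmassE (UX i))).
have -> : \prod_(i < n.+1) vm (U i) = \prod_(A <- codom U) vm A.
  by rewrite codomE big_map big_enum.
have nthU i : U i = nth set0 (codom U) i.
  by rewrite codomE (nth_map i) ?size_enum_ord // nth_ord_enum.
rewrite (nthU ord0) (nthU ord_max).
have : size (codom U) = n.+1 by rewrite size_codom card_ord.
case/lastP: (codom U) => [//|r L]; rewrite size_rcons => -[rn].
rewrite !nth_rcons rn /= n_gt0 ltnn eqxx.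
have := transversal_weight_estimate L (eq_leq rn); rewrite rn.
(* Since [0 < n], the list [r] is nonempty; its head [B] is [U ord0], while [L] is [U ord_max]. *)
case: r rn => [|B r] rn; first by rewrite -rn in n_gt0.
have -> : \prod_(A <- B :: r) (vm A / w [::]) * vm L
    = (\prod_(A <- rcons (B :: r) L) vm A) / w [::] ^+ n.
  rewrite -cats1 big_cat big_seq1 prodf_div /= [RHS]mulrAC; congr (_ / _ * _).
  by rewrite -rn big_const_seq count_predT -[RHS]mulr1 iter_mulr.
by rewrite [vm L * _]mulrC.
Qed.

End OrderedWeight.

(** * The constant, the minimum and the reduction to one pair *)

(** The [k]-th summand on the right is [k + 1] times a difference of positive powers of [k + 2] and
    [k + 1], which is an integer at least 1. *)
Lemma triangular_le_mixing_const (R : realType) n :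
  \sum_(0 <= i < n) i.+1%:R <= mixing_const R n.
Proof.
rewrite /mixing_const big_nat [leRHS]big_nat; apply: ler_sum => k /andP[_ kn].
rewrite exprS -mulrBr ler_peMr // -!natrX -natrB ?leq_exp2r ?subn_gt0 //.
by rewrite ler1n subn_gt0 ltn_exp2r ?subn_gt0.
Qed.

Lemma min_pairs_ge (R : realType) n (f : 'I_n.+1 -> 'I_n.+1 -> R) (x : R) :
  (0 < n)%N -> (forall i j : 'I_n.+1, (i < j)%N -> x <= f i j) -> x <= min_pairs f.
Proof.
move=> n_gt0 x_le; rewrite /min_pairs; elim/big_ind: _ => [|a b xa xb|p].
(* The default value of the minimum belongs to the pair [ord0 < ord_max], which is admissible as
   [0 < n]. *)
- exact: x_le.
- by rewrite le_min xa.
exact: x_le.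
Qed.

Lemma transversals_perm (V : finType) (X : {set {set V}}) n
    (U : 'I_n.+1 -> {set V}) (p : 'S_n.+1) :
  transversals X (U \o p) = transversals X U.
Proof.
apply/setP => t; rewrite !inE; congr (_ && _); apply/forallP/forallP => tU i.
  by rewrite -(permKV p i); exact: tU.
exact: tU.
Qed.

Lemma perm_to_ends n (i j : 'I_n.+1) : i != j ->
  exists2 p : 'S_n.+1, p ord0 = i & p ord_max = j.
Proof.
move=> ij; case: n i j ij => [i j|n i j ij]; first by rewrite !ord1.
(* The first transposition sends [ord0] to [i]; the second sends the new image of [ord_max] to [j]
   and fixes [i], since neither of its two points is [i]. *)
exists (tperm ord0 i * tperm (tperm ord0 i ord_max) j)%g; last first.
  by rewrite permM tpermL.
have max_i : tperm ord0 i ord_max != i.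
  by rewrite -[X in _ != X](tpermL ord0 i) (inj_eq perm_inj).
by rewrite permM tpermL; apply: tpermD max_i _; rewrite eq_sym.
Qed.

Theorem theorem7p1 (R : realType) (V : finType) (n : nat)
    (X : {set {set V}}) (m : {set V} -> R) (lambda : R)
    (n_ge1 : (1 <= n)%N)
    (X_complex : simplicial_complex X)
    (X_pure : pure X n)
    (X_links : connected_links X n)
    (m_balanced : balanced_weight X n m)
    (lambda_bounds : 0 < lambda < 1)
    (X_spec : forall k, (k <= n - 1)%N -> forall tau, tau \in faces X k ->
       forall a : R, a \in walk_spec X m tau ->
         a \in `[- lambda, lambda] \/ a = 1)
    (U : 'I_n.+1 -> {set V})
    (U_vertices : forall i, U i \subset vertices X)
    (U_disjoint : forall i j, i != j -> [disjoint U i & U j]) :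
  `| mass m (transversals X U)
     - (\prod_(i < n.+1) vmass m (U i)) / mass m (faces X 1) ^+ n |
  <= mixing_const R n * lambda
     * min_pairs (fun i j => Num.sqrt (vmass m (U i) * vmass m (U j))).
Proof.
have l_gt0 : 0 < lambda by case/andP: lambda_bounds.
have C_gt0 : 0 < mixing_const R n.
  apply: lt_le_trans (triangular_le_mixing_const R n).
  by rewrite big_ltn // ltr_wpDr ?sumr_ge0.
(* Dividing by the positive factor [mixing_const R n * lambda] reduces the bound by the minimum to
   one bound for each pair [i < j]. *)
rewrite -ler_pdivrMl ?mulr_gt0 //; apply: min_pairs_ge => // i j ij.
rewrite ler_pdivrMl ?mulr_gt0 //.
have [|p <- <-] := @perm_to_ends n i j; first by rewrite neq_ltn ij.
(* The transversals and the product are invariant under [p], so [i] and [j] may be taken as the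
   first and the last index. *)
rewrite -(transversals_perm X U p) (reindex_inj (@perm_inj _ p)) /=.
have spec k : (k < n)%N -> forall tau, tau \in faces X k ->
    forall a : R, a \in walk_spec X m tau -> `|a| <= lambda \/ a = 1.
  move=> kn tau tauX a a_spec; have kn1 : (k <= n - 1)%N by rewrite subn1 -ltnS prednK.
  have [|->] := X_spec k kn1 tau tauX a a_spec; last by right.
  by rewrite in_itv /= -ler_norml; left.
have disjUp i' j' : i' != j' -> [disjoint (U \o p) i' & (U \o p) j'].
  by move=> ij'; apply: U_disjoint; rewrite (inj_eq perm_inj).
apply: le_trans (mixing_head_last X_complex X_links m_balanced (ltW l_gt0) spec
  n_ge1 (fun i' => U_vertices (p i')) disjUp) _.
by rewrite !ler_wpM2r ?sqrtr_ge0 ?(ltW l_gt0) ?triangular_le_mixing_const.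
Qed.
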